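(* There is a connected nilpotent real Lie group $G$ such that the first-order structure $(G,\cdot)$ (the underlying abstract group of $G$ in the language of groups) interprets the structure $(\mathbb{R},+,\cdot,\mathbb{Z})$. Moreover, there is a connected real Lie group $G'$ such that the first-order structure $(G',\cdot)$ (the underlying abstract group of $G'$ in the language of groups) defines $(\mathbb{R},+,\cdot,\mathbb{Z})$.
   Context: A real Lie group is a real analytic manifold (second countable and Hausdorff) equipped with a real analytic group operation. $(\mathbb{R},+,\cdot,\mathbb{Z})$ denotes the first-order structure whose domain is the set of real numbers, with the field operations and a unary predicate for the subset of the integers. ''Definable'' and ''interpretable'' always mean definable or interpretable with parameters. A set is definable in a structure $\mathcal{A}$ if it is a subset of some finite Cartesian power $A^n$ of the domain $A$ of $\mathcal{A}$ that is the solution set of a first-order formula in the language of $\mathcal{A}$ with parameters from $A$. A structure $\mathcal{A}$ interprets a structure $\mathcal{B}$ if there are a definable set $D\subseteq A^n$ (for some $n$), an equivalence relation $\sim$ on $D$ definable in $\mathcal{A}$, and a bijection from the domain of $\mathcal{B}$ to $D/{\sim}$ such that the relations and (graphs of) functions in the signature of $\mathcal{B}$ correspond, under this bijection, to relations on $D/{\sim}$ whose preimages in the Cartesian powers of $D$ are definable in $\mathcal{A}$. A structure $\mathcal{A}$ defines a structure $\mathcal{B}$ if there is a structure $\mathcal{B}'$ isomorphic to $\mathcal{B}$ whose domain is a definable set in $\mathcal{A}$ and such that all relations and (graphs of) functions in the signature of $\mathcal{B}'$ are definable sets in $\mathcal{A}$. Equivalently, $\mathcal{A}$ interprets $\mathcal{B}$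 in such a way that the domain of the interpretation is a definable set in $\mathcal{A}$ (no quotient by an equivalence relation is needed). *)

(* Defs.v *)
From HB Require Import structures.
From mathcomp Require Import all_boot all_order all_algebra.
From mathcomp Require Import all_classical all_reals all_analysis.

Set Implicit Arguments.
Unset Strict Implicit.
Unset Printing Implicit Defensive.

Import Order.TTheory GRing.Theory Num.Theory.
Import numFieldNormedType.Exports.

Local Open Scope classical_set_scope.
Local Open Scope ring_scope.

Record signature := Signature {
  fun_symb : Type;
  fun_arity : fun_symb -> nat;
  rel_symb : Type;
  rel_arity : rel_symb -> nat }.

Record structure (L : signature) (A : Type) := Structure {
  fun_interp : forall f : fun_symb L, ('I_(fun_arity f) -> A) -> A;
  rel_interp : forall r : rel_symb L, ('I_(rel_arity r) -> A) -> Prop }.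

Inductive term (L : signature) (V : Type) : Type :=
| Var of V
| App (f : fun_symb L) of ('I_(fun_arity f) -> term L V).

(* The free variables are indexed by [V]; in the scope of a quantifier,
   [None : option V] is the newly bound variable. *)
Inductive formula (L : signature) (V : Type) : Type :=
| Equal of term L V & term L V
| Rel (r : rel_symb L) of ('I_(rel_arity r) -> term L V)
| Not of formula L V
| And of formula L V & formula L V
| Or of formula L V & formula L V
| Implies of formula L V & formula L V
| Forall of formula L (option V)
| Exists of formula L (option V).

Fixpoint eval (L : signature) (A : Type) (S : structure L A) (V : Type)
    (e : V -> A) (t : term L V) : A :=
  match t with
  | Var x => e x
  | App f ts => fun_interp S (fun i => eval S e (ts i))
  end.

Fixpoint holds (L : signature) (A : Type) (S : structure L A) (V : Type)
    (e : V -> A) (p : formula L V) : Prop :=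
  match p with
  | Equal t u => eval S e t = eval S e u
  | Rel r ts => rel_interp S (fun i => eval S e (ts i))
  | Not p => ~ holds S e p
  | And p q => holds S e p /\ holds S e q
  | Or p q => holds S e p \/ holds S e q
  | Implies p q => holds S e p -> holds S e q
  | Forall p => forall a : A, holds S (oapp e a) p
  | Exists p => exists a : A, holds S (oapp e a) p
  end.

(* Definability with parameters in the Cartesian power [A^I], [I] finite:
   besides the coordinates [inl i], a formula may use every element [a] of the
   domain as a name [inr a] for itself. *)
Definition definable (L : signature) (A : Type) (S : structure L A)
    (I : finType) (X : set (I -> A)) : Prop :=
  exists p : formula L (I + A),
    forall x : I -> A, X x <-> holds S (sum_rect (fun=> A) x id) p.

Definition fun_graph (L : signature) (B : Type) (T : structure L B)
    (f : fun_symb L) : set ('I_(fun_arity f).+1 -> B) :=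
  [set v | v ord_max = fun_interp T (fun i => v (lift ord_max i))].

(* [code b] is the set of [n]-tuples which represent [b]; the relation [P] on
   [B] becomes a relation on [n]-tuples, seen as a subset of [A^(k * n)]. *)
Definition coded_rel (A B : Type) (n k : nat) (code : B -> set ('I_n -> A))
    (P : set ('I_k -> B)) : set ('I_k * 'I_n -> A) :=
  [set v | exists2 b : 'I_k -> B, P b &
             forall i, code (b i) (fun j => v (i, j))].

Definition coded_definable (L K : signature) (A B : Type) (S : structure L A)
    (T : structure K B) (n : nat) (code : B -> set ('I_n -> A)) : Prop :=
  (forall r : rel_symb K,
     definable S (coded_rel code [set v | rel_interp (r := r) T v])) /\
  (forall f : fun_symb K, definable S (coded_rel code (fun_graph T (f := f)))).

Definition equivalence_on (X : Type) (D : set X) (E : X -> X -> Prop) : Prop :=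
  [/\ forall x, D x -> E x x,
      forall x y, D x -> D y -> E x y -> E y x &
      forall x y z, D x -> D y -> D z -> E x y -> E y z -> E x z].

Definition quotient_set (X : Type) (D : set X) (E : X -> X -> Prop) :
    set (set X) :=
  (fun x => [set y | D y /\ E x y]) @` D.

Definition interprets (L K : signature) (A B : Type)
    (S : structure L A) (T : structure K B) : Prop :=
  exists (n : nat) (D : set ('I_n -> A))
         (E : ('I_n -> A) -> ('I_n -> A) -> Prop) (f : B -> set ('I_n -> A)),
    [/\ definable S D,
        equivalence_on D E,
        definable S [set v : 'I_2 * 'I_n -> A |
          let x := fun j => v (ord0, j) in
          let y := fun j => v (ord_max, j) in
          [/\ D x, D y & E x y]],
        set_bij [set: B] (quotient_set D E) f &
        coded_definable S T f].

Definition isomorphic (L : signature) (A B : Type)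
    (S : structure L A) (T : structure L B) : Prop :=
  exists2 f : A -> B, bijective f &
    (forall (g : fun_symb L) (v : 'I_(fun_arity g) -> A),
       f (fun_interp S v) = fun_interp T (f \o v)) /\
    (forall (r : rel_symb L) (v : 'I_(rel_arity r) -> A),
       rel_interp S v <-> rel_interp T (f \o v)).

Definition defines (L K : signature) (A B : Type)
    (S : structure L A) (T : structure K B) : Prop :=
  exists (n : nat) (D : set ('I_n -> A)) (T' : structure K D),
    [/\ definable S D,
        isomorphic T T' &
        coded_definable S T' (fun d : D => [set \val d])].

Definition group_sig : signature :=
  Signature (fun _ : unit => 2%N) (fun _ : void => 0%N).

Definition group_structure (G : groupType) : structure group_sig G :=
  @Structure group_sig G
    (fun=> fun v : 'I_2 -> G => (v ord0 * v ord_max)%g)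
    (fun r _ => match r with end).

Variant ring_op := Plus | Times.

Definition ring_int_sig : signature :=
  Signature (fun _ : ring_op => 2%N) (fun _ : unit => 1%N).

Definition real_int_structure (R : realType) : structure ring_int_sig R :=
  @Structure ring_int_sig R
    (fun f => match f return ('I_2 -> R) -> R with
              | Plus => fun v => v ord0 + v ord_max
              | Times => fun v => v ord0 * v ord_max
              end)
    (fun=> fun v : 'I_1 -> R => v ord0 \is a Num.int).

Fixpoint upper_central (G : groupType) (k : nat) : set G :=
  if k is k'.+1 then
    [set x | forall y : G, @upper_central G k' [~ x, y]%g]
  else [set 1%g].

Definition nilpotent_group (G : groupType) : Prop :=
  exists k : nat, @upper_central G k = [set: G].

(* Partial sum over the multi-indices with all entries below [N]. For an
   absolutely convergent power series, the limit of these sums does not depend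
   on the way the multi-indices are exhausted. *)
Definition power_series_partial (R : realType) (n : nat)
    (c : ('I_n -> nat) -> R) (h : 'rV[R]_n) (N : nat) : R :=
  \sum_(k : {ffun 'I_n -> 'I_N})
     c (fun i => k i) * \prod_(i < n) h ord0 i ^+ k i.

Definition abs_power_series_partial (R : realType) (n : nat)
    (c : ('I_n -> nat) -> R) (h : 'rV[R]_n) (N : nat) : R :=
  \sum_(k : {ffun 'I_n -> 'I_N})
     `|c (fun i => k i) * \prod_(i < n) h ord0 i ^+ k i|.

Definition analytic_at (R : realType) (n m : nat) (f : 'rV[R]_n -> 'rV[R]_m)
    (a : 'rV[R]_n) : Prop :=
  forall j : 'I_m, exists c : ('I_n -> nat) -> R, \forall x \near a,
    cvgn (abs_power_series_partial c (x - a)) /\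
    power_series_partial c (x - a) @ \oo --> f x ord0 j.

(* The values of [chart_map] outside [chart_dom], and those of [chart_inv]
   outside the image of [chart_dom], are irrelevant. *)
Record chart (R : realType) (M : Type) (n : nat) := Chart {
  chart_dom : set M;
  chart_map : M -> 'rV[R]_n;
  chart_inv : 'rV[R]_n -> M }.

Definition is_chart (R : realType) (M : topologicalType) (n : nat)
    (c : chart R M n) : Prop :=
  let U := chart_dom c in
  let W := chart_map c @` U in
  [/\ open U, open W,
      forall p, U p -> chart_inv c (chart_map c p) = p,
      {within U, continuous (chart_map c)} &
      {within W, continuous (chart_inv c)}].

Definition analytic_atlas (R : realType) (M : topologicalType) (n : nat)
    (A : set (chart R M n)) : Prop :=
  [/\ forall c, A c -> is_chart c,
      forall p : M, exists2 c, A c & chart_dom c p &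
      forall c d, A c -> A d ->
        forall p, chart_dom c p -> chart_dom d p ->
          analytic_at (chart_map d \o chart_inv c) (chart_map c p)].

Definition analytic_map (R : realType) (M N : topologicalType) (m n : nat)
    (A : set (chart R M m)) (B : set (chart R N n)) (f : M -> N) : Prop :=
  continuous f /\
  forall c d, A c -> B d ->
    forall p, chart_dom c p -> chart_dom d (f p) ->
      analytic_at (chart_map d \o f \o chart_inv c) (chart_map c p).

Definition prod_chart (R : realType) (M N : Type) (m n : nat)
    (c : chart R M m) (d : chart R N n) : chart R (M * N)%type (m + n) :=
  Chart (chart_dom c `*` chart_dom d)
    (fun p => row_mx (chart_map c p.1) (chart_map d p.2))
    (fun v => (chart_inv c (lsubmx v), chart_inv d (rsubmx v))).

Definition prod_atlas (R : realType) (M N : Type) (m n : nat)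
    (A : set (chart R M m)) (B : set (chart R N n)) :
    set (chart R (M * N)%type (m + n)) :=
  [set prod_chart c d | c in A & d in B].

HB.mixin Record isAnalyticManifold (R : realType) M of Topological M := {
  manifold_dim : nat;
  manifold_atlas : set (chart R M manifold_dim);
  manifold_atlasP : analytic_atlas manifold_atlas;
  manifold_hausdorff : hausdorff_space M;
  manifold_second_countable : @second_countable M }.

#[short(type="analyticManifoldType")]
HB.structure Definition AnalyticManifold (R : realType) :=
  {M of isAnalyticManifold R M & Topological M}.

HB.mixin Record isLieGroup (R : realType) G
    of AnalyticManifold R G & Group G := {
  lie_mul_analytic : analytic_map
    (prod_atlas (manifold_atlas (R := R) (s := G)) manifold_atlas)
    (manifold_atlas (s := G)) (fun xy : G * G => (xy.1 * xy.2)%g);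
  lie_inv_analytic : analytic_map
    (manifold_atlas (R := R) (s := G)) (manifold_atlas (s := G))
    (fun x : G => (x^-1)%g) }.

#[short(type="lieGroupType")]
HB.structure Definition LieGroup (R : realType) :=
  {G of isLieGroup R G & AnalyticManifold R G & Group G}.

(* Main.v *)
Require Import Defs.
From HB Require Import structures.
From mathcomp Require Import all_boot all_order all_algebra.
From mathcomp Require Import all_classical all_reals all_analysis.
From mathcomp Require Import ring lra.

(** Let [H] be the group [R^5] with the polynomial law
    [(x * y)_j = x_j + y_j] for [j < 3],
    [(x * y)_3 = x_3 + y_3 + x_0 y_1], [(x * y)_4 = x_4 + y_4 + x_0 y_2],
    and divide it by the central discrete subgroup [Z e_4].  The commutator of
    [x] and [y] in the quotient is the central element with coordinates
    [x_0 y_1 - y_0 x_1] and [x_0 y_2 - y_0 x_2 mod 1].  Hence the commutators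
    with [e_1] form a definable copy [L] of the additive group of [R], the
    multiplication of [L] is read off the first coordinate of commutators, and
    the integers are the elements [[u, e_1]] with [[u, e_2] = 1].  As [L] is
    a subset of the group, this one nilpotent group witnesses both claims. *)

Set Implicit Arguments.
Unset Strict Implicit.
Unset Printing Implicit Defensive.

Import Order.TTheory GRing.Theory Num.Theory.
Import numFieldNormedType.Exports.
Import Defs.

Local Open Scope classical_set_scope.
Local Open Scope ring_scope.

(** * Renaming of variables, closure of definable sets, and transport of structures *)

Section Definability.
Variable L : signature.

Fixpoint rename_term (V W : Type) (g : V -> W) (t : term L V) : term L W :=
  match t with
  | Var x => Var L (g x)
  | App f ts => App (fun i => rename_term g (ts i))
  end.

Fixpoint rename (V W : Type) (g : V -> W) (p : formula L V) : formula L W :=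
  match p with
  | Equal t u => Equal (rename_term g t) (rename_term g u)
  | Rel r ts => Rel (fun i => rename_term g (ts i))
  | Not p => Not (rename g p)
  | And p q => And (rename g p) (rename g q)
  | Or p q => Or (rename g p) (rename g q)
  | Implies p q => Implies (rename g p) (rename g q)
  | Forall p => Forall (rename (omap g) p)
  | Exists p => Exists (rename (omap g) p)
  end.

Variables (A : Type) (S : structure L A).

Lemma eval_rename (V W : Type) (g : V -> W) (e : W -> A) (t : term L V) :
  eval S e (rename_term g t) = eval S (e \o g) t.
Proof.
elim: t => //= f ts IH.
by congr fun_interp; apply/funext.
Qed.

Lemma holds_rename (V W : Type) (g : V -> W) (e : W -> A) (p : formula L V) :
  holds S e (rename g p) <-> holds S (e \o g) p.
Proof.
(* [omap h] fixes the bound variable [None], so it commutes with extending the assignment. *)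
have oappE V1 W1 (h : V1 -> W1) e1 (a : A) :
  oapp e1 a \o omap h = oapp (e1 \o h) a by apply/funext => -[].
elim: p W g e => {V} [V t u|V r ts|V p IH|V p IHp q IHq|V p IHp q IHq
  |V p IHp q IHq|V p IH|V p IH] W g e /=.
- by rewrite !eval_rename.
- by under eq_fun do rewrite eval_rename.
- by rewrite IH.
- by rewrite IHp IHq.
- by rewrite IHp IHq.
- by rewrite IHp IHq.
- by split=> h a; have := h a; rewrite IH oappE.
- by split=> -[a h]; exists a; move: h; rewrite IH oappE.
Qed.

(** Coordinates may thus be permuted, repeated or added; parameters name themselves and are left
    alone by the renaming. *)
Lemma definable_reindex (I J : finType) (g : J -> I) (X : set (J -> A)) :
  definable S X -> definable S [set v : I -> A | X (v \o g)].
Proof.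
move=> [p pP]; exists (rename (sum_rect (fun=> (I + A)%type) (inl \o g) inr) p).
move=> v /=; rewrite holds_rename (pP (v \o g)).
rewrite (_ : _ \o _ = sum_rect (fun=> A) (v \o g) id) //.
by apply/funext => -[].
Qed.

Lemma definableI (I : finType) (X Y : set (I -> A)) :
  definable S X -> definable S Y -> definable S (X `&` Y).
Proof.
by move=> [p pP] [q qP]; exists (And p q) => v /=; rewrite -pP -qP.
Qed.

(** Formulas have no constant for truth, and an open equation would need a variable in [I + A],
    which may be empty; a quantified [x = x] avoids this. *)
Lemma definableT (I : finType) : definable S [set: I -> A].
Proof.
exists (Forall (Equal (Var L None) (Var L None))) => v /=; split => //.
Qed.

Lemma definable_forall_fin (I J : finType) (X : J -> set (I -> A)) :
  (forall j, definable S (X j)) -> definable S [set v | forall j, X j v].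
Proof.
move=> Xdef; suff /(_ (enum J)) : forall s : seq J,
    definable S [set v | forall j, j \in s -> X j v].
  congr definable; apply/seteqP; split=> v /= h j; last by move=> _.
  by apply: h; rewrite mem_enum.
elim=> [|j s IH].
  by have := definableT I; congr definable; apply/seteqP; split.
have := definableI (Xdef j) IH; congr definable; apply/seteqP; split=> v /=.
  by move=> [h1 h2] k; rewrite inE => /predU1P[->|/h2].
by move=> h; split=> [|k ks]; apply: h; rewrite inE ?eqxx ?ks ?orbT.
Qed.

Lemma definable_eq (I : finType) (i j : I) :
  definable S [set v : I -> A | v i = v j].
Proof. by exists (Equal (Var L (inl i)) (Var L (inl j))). Qed.

Lemma coded_rel_comp (B C : Type) (n k : nat) (f : B -> C) (g : C -> B)
    (code : C -> set ('I_n -> A)) (P : set ('I_k -> B)) (Q : set ('I_k -> C)) :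
  cancel g f -> (forall b, P b <-> Q (f \o b)) ->
  coded_rel (code \o f) P = coded_rel code Q.
Proof.
move=> gK PQ; apply/seteqP; split=> v /= [b Pb bv].
  by exists (f \o b); first exact/PQ.
exists (g \o b); last by move=> i /=; rewrite gK; exact: bv.
by rewrite PQ (_ : f \o _ = b) //; apply/funext=> i /=; exact: gK.
Qed.

(** Both codings yield the same subsets of powers of [A], so the same formulas serve. *)
Lemma coded_definable_iso (K : signature) (B C : Type) (T : structure K B)
    (T' : structure K C) (n : nat) (f : B -> C) (code : C -> set ('I_n -> A)) :
  bijective f ->
  (forall h v, f (fun_interp (f := h) T v) = fun_interp T' (f \o v)) ->
  (forall r v, rel_interp (r := r) T v <-> rel_interp T' (f \o v)) ->
  coded_definable S T (code \o f) <-> coded_definable S T' code.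
Proof.
move=> [g fK gK] funf relf.
have rE r : coded_rel (code \o f) [set v | rel_interp (r := r) T v] =
    coded_rel code [set v | rel_interp (r := r) T' v].
  by apply: (coded_rel_comp _ gK) => b; exact: relf.
have fE h : coded_rel (code \o f) (fun_graph T (f := h)) =
    coded_rel code (fun_graph T' (f := h)).
  apply: (coded_rel_comp _ gK) => b; rewrite /fun_graph /=.
  by split=> [->|e]; [exact: funf|apply: (can_inj fK); rewrite e funf].
by split=> -[dr df]; split=> [r|h]; rewrite ?rE ?fE // -?rE -?fE.
Qed.

(** The structure [T] is copied onto the definable range of [j], whose elements then code
    themselves, as [defines] demands. *)
Lemma defines_of_injection (K : signature) (B : Type) (T : structure K B)
    (n : nat) (j : B -> 'I_n -> A) :
  injective j -> definable S (range j) ->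
  coded_definable S T (fun b => [set j b]) -> defines S T.
Proof.
move=> j_inj jdef Tdef.
pose f (b : B) : range j := SigSub (mem_set (imageT j b)).
(* A chosen preimage; injectivity of [j] makes it a two-sided inverse of [f]. *)
pose g (d : range j) : B := projT1 (cid2 (set_valP d)).
have gK : cancel g f.
  by move=> d; apply: val_inj; rewrite /= /g; case: cid2.
have fK : cancel f g by move=> b; apply: j_inj; exact: (congr1 \val (gK (f b))).
pose T' := @Structure K (range j)
  (fun _ v => f (fun_interp T (g \o v))) (fun _ v => rel_interp T (g \o v)).
have gfE (I : Type) (v : I -> B) : g \o (f \o v) = v.
  by apply/funext => i; exact: fK.
have f_bij : bijective f by exists g.
have funf h v : f (fun_interp (f := h) T v) = fun_interp T' (f \o v).
  by rewrite /= gfE.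
have relf r v : rel_interp (r := r) T v <-> rel_interp T' (f \o v).
  by rewrite /= gfE.
exists n, (range j), T'; split=> //; first by exists f.
exact/(coded_definable_iso (fun d : range j => [set \val d]) f_bij funf relf).
Qed.

Lemma defines_interprets (K : signature) (B : Type) (T : structure K B) :
  defines S T -> interprets S T.
Proof.
move=> [n [D [T' [Ddef [f f_bij [funf relf]] T'def]]]].
(* With equality as equivalence relation every class is a singleton, and the relation is definable
   coordinate by coordinate. *)
exists n, D, eq, (fun b => [set \val (f b)]).
split=> //.
- by split=> // x y z _ _ _ -> ->.
- pose g0 (i : 'I_2) (j : 'I_n) := (i, j).
  have := definableI (definable_reindex (g0 ord0) Ddef)
    (definableI (definable_reindex (g0 ord_max) Ddef)
      (definable_forall_fin (fun j => definable_eq (ord0, j) (ord_max, j)))).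
  congr definable; apply/seteqP; split=> v /=; last first.
    by move=> [? ? e]; do !split => //; move=> j; rewrite (congr1 (@^~ j) e).
  by move=> [? [? e]]; split=> //; apply/funext.
- have imE x : D x -> [set y | D y /\ x = y] = [set x].
    by move=> Dx; apply/seteqP; split=> y /= => [[]|->].
  split.
  + move=> b _ /=; exists (\val (f b)); first exact: set_valP.
    exact/imE/set_valP.
  + move=> b c _ _ /= /seteqP[/(_ _ erefl)/= e _].
    by apply: (bij_inj f_bij); exact: val_inj.
  + have [g _ gK] := f_bij.
    move=> _ [x Dx <-]; exists (g (SigSub (mem_set Dx))) => //=.
    by rewrite gK imE.
- exact/(coded_definable_iso (fun d : D => [set \val d]) f_bij funf relf).
Qed.

End Definability.

(** * Polynomials as power series *)

Section Polynomial.
Variables (R : realType) (n : nat).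
Implicit Types (c : ('I_n -> nat) -> R) (a x : 'rV[R]_n).

(** Multi-indices with an entry above [D] contribute zero; the others are matched by [widen_ord],
    with inverse [inord]. Hence the partial sums of a polynomial stabilise. *)
Lemma sum_ffun_ord (F : ('I_n -> nat) -> R) (D N : nat) :
  (forall k i, (D < k i)%N -> F k = 0) -> (D < N)%N ->
  \sum_(k : {ffun 'I_n -> 'I_N}) F (fun i => k i) =
  \sum_(k : {ffun 'I_n -> 'I_D.+1}) F (fun i => k i).
Proof.
move=> F0 DN; pose P (k : {ffun 'I_n -> 'I_N}) := [forall i, k i < D.+1]%N.
rewrite (bigID P) /= [X in _ + X]big1 ?addr0 => [|k]; last first.
  by rewrite negb_forall => /existsP[i]; rewrite -leqNgt; exact: F0.
pose w (k : {ffun 'I_n -> 'I_D.+1}) := [ffun i => widen_ord DN (k i)].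
pose r (k : {ffun 'I_n -> 'I_N}) := [ffun i => inord (k i) : 'I_D.+1].
rewrite (reindex_onto w r) => [|k /forallP Pk]; last first.
  by apply/ffunP => i; apply: val_inj; rewrite !ffunE /= inordK.
apply: eq_big => [k|k _]; last by congr F; apply/funext => i; rewrite ffunE.
have -> : P (w k) by apply/forallP => i; rewrite ffunE /=.
by apply/eqP/ffunP => i; apply: val_inj; rewrite !ffunE /= inordK.
Qed.

(** [D] bounds each exponent separately, since partial sums run over boxes of multi-indices. *)
Definition polynomial_at a (f : 'rV[R]_n -> R) : Prop :=
  exists c D, (forall k i, (D < k i)%N -> c k = 0) /\
    forall x N, (D < N)%N -> power_series_partial c (x - a) N = f x.

(** Both sequences of partial sums are constant from [D.+1] on, at every [x]. *)
Lemma polynomial_analytic_at m (f : 'rV[R]_n -> 'rV[R]_m) a :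
  (forall j, polynomial_at a (fun x => f x ord0 j)) -> analytic_at f a.
Proof.
move=> fP j; have [c [D [c0 cf]]] := fP j; exists c.
apply: (@filterE _ (nbhs a) (nbhs_filter a)) => x.
split.
  apply: (@cvgP _ _ (abs_power_series_partial c (x - a) D.+1)).
  apply: cvg_near_cst; exists D.+1 => // N DN.
  apply: (@sum_ffun_ord
    (fun k => `|c k * \prod_(i < n) (x - a) ord0 i ^+ k i|)).
    by move=> k i ki; rewrite (c0 _ _ ki) mul0r normr0.
  exact: DN.
by apply: cvg_near_cst; exists D.+1 => // N; exact: cf.
Qed.

Lemma near_analytic_at m (f g : 'rV[R]_n -> 'rV[R]_m) a :
  (\forall x \near a, f x = g x) -> analytic_at g a -> analytic_at f a.
Proof.
move=> fg gA j; have [c cP] := gA j; exists c.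
by apply: (filterS2 (nbhs_filter a) _ fg cP) => x ->.
Qed.

Lemma polynomial_at_add a f g : polynomial_at a f -> polynomial_at a g ->
  polynomial_at a (fun x => f x + g x).
Proof.
move=> [c [D [c0 cf]]] [d [E [d0 dg]]].
exists (fun k => c k + d k), (maxn D E); split=> [k i|x N].
  by rewrite gtn_max => /andP[/c0-> /d0->]; rewrite addr0.
rewrite gtn_max => /andP[DN EN]; rewrite -(cf _ _ DN) -(dg _ _ EN) -big_split.
by rewrite /power_series_partial; apply: eq_bigr => k _; rewrite mulrDl.
Qed.

Lemma polynomial_at_scale a b f : polynomial_at a f ->
  polynomial_at a (fun x => b * f x).
Proof.
move=> [c [D [c0 cf]]]; exists (fun k => b * c k), D.
split=> [k i /c0->|x N DN].
  by rewrite mulr0.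
rewrite -(cf _ _ DN) /power_series_partial mulr_sumr.
by apply: eq_bigr => k _; rewrite mulrA.
Qed.

Lemma polynomial_at_monomial a (k : 'I_n -> nat) :
  polynomial_at a (fun x => \prod_i (x - a) ord0 i ^+ k i).
Proof.
(* The coefficients are the indicator of [k], so a single term of the sum survives. *)
exists (fun l => [forall i, l i == k i]%:R), (\max_i k i).
split=> [l i|x [//|N] DN].
  rewrite ltnNge; case: forallP => // /(_ i)/eqP ->.
  by rewrite leq_bigmax.
pose k' : {ffun 'I_n -> 'I_N.+1} := [ffun i => inord (k i)].
have k'E i : k' i = k i :> nat.
  by rewrite ffunE inordK // (leq_ltn_trans _ DN) // leq_bigmax.
rewrite /power_series_partial (bigD1 k') //= [X in _ + X]big1 ?addr0 => [|l lk].
  case: forallP => [_|[]]; last by move=> i; rewrite k'E.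
  by rewrite mul1r; apply: eq_bigr => i _; rewrite k'E.
case: forallP => [lE|_]; last by rewrite mul0r.
by case/eqP: lk; apply/ffunP => i; apply: val_inj; rewrite /= k'E; exact/eqP.
Qed.

Lemma polynomial_at_cst a b : polynomial_at a (fun=> b).
Proof.
have := polynomial_at_scale b (polynomial_at_monomial a (fun=> 0%N)).
by congr polynomial_at; apply/funext => x; rewrite big1 ?mulr1.
Qed.

Lemma prod_exp_eq (h : 'I_n -> R) i : \prod_l h l ^+ (l == i) = h i.
Proof.
by rewrite (bigD1 i) //= eqxx big1 ?mulr1 // => l /negPf ->.
Qed.

Lemma polynomial_at_coord a i : polynomial_at a (fun x => x ord0 i).
Proof.
have := polynomial_at_add (polynomial_at_cst a (a ord0 i))
  (polynomial_at_monomial a (fun l => l == i)).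
congr polynomial_at; apply/funext => x.
by rewrite prod_exp_eq !mxE; ring.
Qed.

(** Expand around [a]: [x_i x_j = a_j x_i + a_i x_j - a_i a_j + (x_i - a_i)(x_j - a_j)]. Adding
    exponents in the last monomial covers [i = j] as well. The group law needs no higher degree. *)
Lemma polynomial_at_coordM a i j :
  polynomial_at a (fun x => x ord0 i * x ord0 j).
Proof.
have := polynomial_at_add (polynomial_at_add
    (polynomial_at_scale (a ord0 j) (polynomial_at_coord a i))
    (polynomial_at_scale (a ord0 i) (polynomial_at_coord a j)))
  (polynomial_at_add (polynomial_at_cst a (- (a ord0 i * a ord0 j)))
  (polynomial_at_monomial a (fun l => (l == i) + (l == j))%N)).
congr polynomial_at; apply/funext => x.
under eq_bigr do rewrite exprD.
by rewrite big_split /= !prod_exp_eq !mxE; ring.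
Qed.

End Polynomial.

(** * The group law on [R^5] and the quotient by a discrete central subgroup *)

Section HeisenbergSpace.
Local Open Scope quotient_scope.
Variable R : realType.
Implicit Types x y z : 'rV[R]_5.

Local Notation o k := (@Ordinal 5 k isT).

Definition axis (i : 'I_5) : 'rV[R]_5 := delta_mx ord0 i.

(** A bilinear map that reads only coordinates 0, 1, 2 and takes values in the span of [e_3] and
    [e_4]. It is therefore a 2-cocycle, and [vmul] is the central extension of [R^3] by [R^2] that
    it defines. *)
Definition cocycle x y : 'rV[R]_5 :=
  (x ord0 (o 0) * y ord0 (o 1)) *: axis (o 3) +
  (x ord0 (o 0) * y ord0 (o 2)) *: axis (o 4).

Definition vmul x y : 'rV[R]_5 := x + y + cocycle x y.
Definition vinv x : 'rV[R]_5 := - x + cocycle x x.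

(** Writing the axes as Kronecker deltas lets [ring] settle the group identities coordinatewise. *)
Lemma vmulE x y j : vmul x y ord0 j = x ord0 j + y ord0 j +
  x ord0 (o 0) * y ord0 (o 1) * (j == o 3)%:R +
  x ord0 (o 0) * y ord0 (o 2) * (j == o 4)%:R.
Proof. by rewrite !mxE /=; ring. Qed.

Lemma vinvE x j : vinv x ord0 j = - x ord0 j +
  x ord0 (o 0) * x ord0 (o 1) * (j == o 3)%:R +
  x ord0 (o 0) * x ord0 (o 2) * (j == o 4)%:R.
Proof. by rewrite !mxE /=; ring. Qed.

Lemma vmulA : associative vmul.
Proof. by move=> x y z; apply/rowP => j; rewrite !vmulE /=; ring. Qed.

Lemma vmul0 x : vmul x 0 = x.
Proof. by apply/rowP => j; rewrite !vmulE !mxE; ring. Qed.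

Lemma v0mul x : vmul 0 x = x.
Proof. by apply/rowP => j; rewrite !vmulE !mxE; ring. Qed.

Lemma vmulV x : vmul x (vinv x) = 0.
Proof. by apply/rowP => j; rewrite !vmulE !vinvE !mxE /=; ring. Qed.

Lemma vVmul x : vmul (vinv x) x = 0.
Proof. by apply/rowP => j; rewrite !vmulE !vinvE !mxE /=; ring. Qed.

(** This is multiplication by the central element [k e_4], so its orbits are the cosets of the
    subgroup divided out. *)
Definition shift (k : int) x : 'rV[R]_5 := x + k%:~R *: axis (o 4).

Lemma shiftE k x j : shift k x ord0 j = x ord0 j + k%:~R * (j == o 4)%:R.
Proof. by rewrite !mxE. Qed.

Lemma shift0 x : shift 0 x = x.
Proof. by rewrite /shift scale0r addr0. Qed.

Lemma shiftD k l x : shift k (shift l x) = shift (k + l) x.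
Proof. by apply/rowP => j; rewrite !shiftE rmorphD /=; ring. Qed.

(** As [e_4] is central, shifts of the factors add up; this lets the law descend to classes. *)
Lemma vmul_shift k l x y :
  vmul (shift k x) (shift l y) = shift (k + l) (vmul x y).
Proof. by apply/rowP => j; rewrite !(vmulE, shiftE) rmorphD /=; ring. Qed.

Lemma vinv_shift k x : vinv (shift k x) = shift (- k) (vinv x).
Proof. by apply/rowP => j; rewrite !(vinvE, shiftE) rmorphN /=; ring. Qed.

Definition shift_rel x y : bool := `[< exists k, y = shift k x >].

Lemma shift_rel_equiv : equiv_class_of shift_rel.
Proof.
split=> [x|x y|y x z].
- by apply/asboolP; exists 0; rewrite shift0.
- apply/asboolP/asboolP => -[k ->]; exists (- k).
    by rewrite shiftD addNr shift0.
  by rewrite shiftD addNr shift0.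
- move=> /asboolP[k ->] /asboolP[l ->]; apply/asboolP; exists (l + k).
  by rewrite shiftD.
Qed.

Canonical shift_equiv := EquivRelPack shift_rel_equiv.

Definition heis : Type := quotient_topology {eq_quot shift_equiv}.
HB.instance Definition _ := Topological.on heis.

Definition proj (x : 'rV[R]_5) : heis :=
  \pi_(quotient_topology {eq_quot shift_equiv}) x.
Definition heis_repr (p : heis) : 'rV[R]_5 :=
  repr (p : quotient_topology {eq_quot shift_equiv}).

Lemma heis_reprK : cancel heis_repr proj.
Proof. exact: reprK. Qed.

Lemma projP x y : proj x = proj y <-> exists k, y = shift k x.
Proof.
split=> [/eqmodP/asboolP //|e].
by apply/eqmodP/asboolP.
Qed.

Lemma proj_continuous : continuous proj.
Proof. exact: pi_continuous. Qed.

End HeisenbergSpace.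

(** * Topology and charts of the quotient *)

Section HeisenbergTopology.
Variable R : realType.
Implicit Types (x y z : 'rV[R]_5) (p q : heis R).

Local Notation o k := (@Ordinal 5 k isT).

Lemma shift_continuous k : continuous (@shift R k).
Proof.
move=> x; apply: (@continuousD _ _ _ id (fun=> _)); first exact: cvg_id.
exact: cst_continuous.
Qed.

(** The saturation of [U] is the union of its preimages under all shifts. *)
Lemma proj_open (U : set 'rV[R]_5) : open U -> open (@proj R @` U).
Proof.
move=> oU; rewrite /open /= /quotient_open.
rewrite [X in open X](_ : _ = \bigcup_k (shift k @^-1` U)).
  apply: bigcup_open => k _; apply: open_comp => // x _.
  exact: shift_continuous.
apply/seteqP; split=> [x [y Uy /esym/projP[k yE]]|x [k _ Uk]] /=.
  by exists k => //=; rewrite -yE.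
by exists (shift k x) => //; apply/esym/projP; exists k.
Qed.

Lemma nbhs_proj x (A : set (heis R)) :
  nbhs (proj x) A <-> nbhs x (@proj R @^-1` A).
Proof.
split=> [|]; first exact: proj_continuous.
rewrite nbhsE => -[U [oU Ux] UA]; rewrite nbhsE; exists (@proj R @` U).
  by split; [exact: proj_open|exists x].
by move=> _ [y Uy <-]; exact: UA.
Qed.

Lemma proj_image_nbhs x (A : set 'rV[R]_5) :
  nbhs x A -> nbhs (proj x) (@proj R @` A).
Proof.
by move=> xA; apply/nbhs_proj; apply: filterS xA => y Ay; exists y.
Qed.

(** If the neighbourhoods of two classes always meet, shifts of [x] come arbitrarily close to [y].
    Distinct shifts are at distance at least 1, so one and the same shift does so, and it equals
    [y]. *)
Lemma heis_hausdorff : hausdorff_space (heis R).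
Proof.
move=> p q; rewrite -(heis_reprK p) -(heis_reprK q).
move: (heis_repr p) (heis_repr q) => x y xy; apply/projP.
have near_shift (e : R) : 0 < e -> exists k, `|y - shift k x| < e.
  move=> e0; have e20 : 0 < e / 2 by rewrite divr_gt0.
  have [_ [[x' x'x <-] [y' y'y]]] := xy _ _
    (proj_image_nbhs (nbhsx_ballx x _ e20))
    (proj_image_nbhs (nbhsx_ballx y _ e20)).
  move=> /esym/projP[k y'E]; exists k.
  move: x'x y'y; rewrite -!ball_normE /ball_ /= => x'x y'y.
  rewrite (_ : y - shift k x = (y - y') - (x - x')); last first.
    by apply/rowP => j; rewrite y'E !mxE; ring.
  by rewrite (le_lt_trans (ler_normB _ _)) // [ltRHS]splitr ltrD.
have coord_le (v : 'rV[R]_5) j : `|v ord0 j| <= `|v|.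
  rewrite [leRHS]mx_normrE.
  exact: (le_bigmax _ (fun i => `|v i.1 i.2|) (ord0, j)).
(* Two shifts within 1/2 of [y] have last coordinates less than 1 apart, so their integers agree. *)
have [k k1] := near_shift (1 / 2) ltac:(by rewrite divr_gt0).
exists k; apply/eqP; rewrite -subr_eq0 -normr_le0; apply/ler_addgt0Pl => e e0.
rewrite addr0.
have [l] := near_shift (Num.min (1 / 2) e) ltac:(by rewrite lt_min e0 divr_gt0).
rewrite lt_min => /andP[l1 le].
suff -> : k = l by exact: ltW.
apply/eqP; rewrite -subr_eq0 -normr_le0 -ltzD1 add0r -(ltr_int R) intr_norm.
have := coord_le ((y - shift l x) - (y - shift k x)) (o 4).
rewrite !mxE rmorphB /= => kl.
rewrite [ltRHS]splitr.
apply: le_lt_trans (ltrD l1 k1); rewrite (le_trans _ (ler_normB _ _)) //.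
apply: le_trans kl; rewrite le_eqVlt; apply/orP; left; apply/eqP.
by congr (`|_|); ring.
Qed.

(** The images of balls with rational centre and radius [1 / (n + 1)] form a countable base because
    [proj] is open. *)
Lemma heis_second_countable : @second_countable (heis R).
Proof.
pose B (rn : 'rV[rat]_5 * nat) : set (heis R) :=
  @proj R @` ball (map_mx ratr rn.1 : 'rV[R]_5) rn.2.+1%:R^-1.
exists (range B); first exact: sub_countable (card_image_le _ _) (countableP _).
split=> [_ [rn _ <-]|p]; first by apply/proj_open/ball_open.
rewrite -(heis_reprK p); move: (heis_repr p) => x A.
move=> /nbhs_proj /nbhs_ballP[e /= e0 xA].
have [n ne] : exists n, n.+1%:R^-1 < e / 2 :> R.
  have [|n] := @ltr_add_invr R 0 (e / 2); first by rewrite divr_gt0.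
  by rewrite add0r; exists n.
have /choice[r rP] : forall j,
    exists r : rat, `|x ord0 j - ratr r| < n.+1%:R^-1.
  move=> j; have : x ord0 j - n.+1%:R^-1 < x ord0 j + n.+1%:R^-1.
    by rewrite ltrBlDr -addrA ltrDl addr_gt0 ?invr_gt0.
  move=> /rat_in_itvoo[r]; rewrite in_itv /= => /andP[r1 r2]; exists r.
  by rewrite distrC ltr_distl r1 r2.
have xr : ball (map_mx ratr (\row_j r j) : 'rV[R]_5) n.+1%:R^-1 x.
  by split=> // i j; rewrite ord1 !mxE /ball /= distrC.
exists (B (\row_j r j, n)).
  by split; [exists (\row_j r j, n)|exists x].
move=> _ [y yr <-]; apply: xA; rewrite (splitr e).
apply: (@ball_triangle _ 'rV[R]_5 (map_mx ratr (\row_j r j))).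
  exact: le_ball (ltW ne) _ (ball_sym xr).
exact: le_ball (ltW ne) _ yr.
Qed.

Lemma heis_connected : connected [set: heis R].
Proof.
(* The sets of multiples of a vector are connected and all contain 0. *)
have -> : [set: heis R] = @proj R @` (\bigcup_x (range (fun t : R => t *: x))).
  apply/seteqP; split=> // p _; exists (heis_repr p); last exact: heis_reprK.
  by exists (heis_repr p) => //; exists 1 => //; rewrite scale1r.
apply: connected_continuous_connected; last first.
  by apply: continuous_subspaceT; exact: proj_continuous.
apply: bigcup_connected.
  by exists 0 => x _; exists 0 => //; rewrite scale0r.
move=> x _; apply: connected_continuous_connected.
  by apply/connected_intervalP => ? ? _ _ ? _.
apply: continuous_subspaceT => t; exact: scalel_continuous.
Qed.

(* The representative of the class of [x] with last coordinate in
   [[a, a + 1)]. *)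
Definition sheet (a : R) x := shift (- Num.floor (x ord0 (o 4) - a)) x.

(** An open strip of width 1 contains no two distinct shifts of a point, so [proj] is injective on
    it. *)
Definition strip (a : R) : set 'rV[R]_5 :=
  [set x | a < x ord0 (o 4) < a + 1].

(** [heis_repr] picks an arbitrary representative; [sheet a] normalises it and removes the
    dependence on that choice. *)
Definition strip_chart (a : R) : chart R (heis R) 5 :=
  Chart (@proj R @` strip a) (sheet a \o @heis_repr R) (@proj R).

Lemma proj_sheet a x : proj (sheet a x) = proj x.
Proof. by apply/esym/projP; eexists. Qed.

Lemma sheet_shift a k x : sheet a (shift k x) = sheet a x.
Proof.
rewrite /sheet shiftD shiftE eqxx mulr1 addrAC floorDrz ?intr_int //.
by rewrite intrKfloor opprD addrNK.
Qed.

Lemma sheet_repr a x : sheet a (heis_repr (proj x)) = sheet a x.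
Proof. by have /projP[k {2}->] := heis_reprK (proj x); rewrite sheet_shift. Qed.

Lemma sheet_strip a x : strip a x -> sheet a x = x.
Proof.
rewrite /strip /= => /andP[ax xa];
rewrite /sheet (floor_def (m := 0)) ?shift0 //.
by rewrite subr_ge0 add0r ltrBlDl xa ltW.
Qed.

Lemma strip_sheet a x : (@proj R @` strip a) (proj x) -> strip a (sheet a x).
Proof.
move=> [y ys /(congr1 (@heis_repr R))/(congr1 (sheet a))].
by rewrite !sheet_repr (sheet_strip ys) => <-.
Qed.

(** In the open strip the argument of the floor lies strictly between two integers, so the floor is
    constant nearby and [sheet a] acts as one fixed shift. This gives continuity of charts and turns
    maps read in charts into polynomials. *)
Lemma sheet_near (T : topologicalType) (g : T -> 'rV[R]_5) a t :
  {for t, continuous (fun s => g s ord0 (o 4))} ->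
  strip a (sheet a (g t)) ->
  exists k, \forall s \near t, sheet a (g s) = shift k (g s).
Proof.
move=> gc; set m := Num.floor (g t ord0 (o 4) - a).
rewrite /strip /sheet /= shiftE eqxx mulr1 rmorphN /= -/m => /andP[am ma].
exists (- m).
have near1 : \forall s \near t, a + m%:~R < g s ord0 (o 4).
  by apply: (cvgr_gt _ gc); rewrite -ltrBrDr.
have near2 : \forall s \near t, g s ord0 (o 4) < a + 1 + m%:~R.
  by apply: (cvgr_lt _ gc); rewrite -ltrBlDr.
apply: (filterS2 (nbhs_filter t) _ near1 near2) => s s1 s2.
rewrite (floor_def (m := m)) // rmorphD /= lerBrDl (ltW s1) ltrBlDl.
by rewrite (addrC m%:~R) addrA.
Qed.

Lemma coord4_continuous : continuous (fun x => x ord0 (o 4)).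
Proof. exact: coord_continuous. Qed.

Lemma strip_open a : open (strip a).
Proof.
have -> : strip a = (fun x => x ord0 (o 4)) @^-1` `]a, a + 1[.
  by apply/seteqP; split=> x; rewrite /strip /= in_itv.
by apply: open_comp => [x _|]; [exact: coord4_continuous|exact: interval_open].
Qed.

Lemma strip_chart_image a :
  chart_map (strip_chart a) @` chart_dom (strip_chart a) = strip a.
Proof.
apply/seteqP; split=> [_ [_ [x xs <-] <-]|x xs] /=.
  by rewrite sheet_repr sheet_strip.
exists (proj x); first by exists x.
by rewrite sheet_repr sheet_strip.
Qed.

Lemma continuous_at_proj (T : topologicalType) (f : heis R -> T) x :
  {for x, continuous (f \o @proj R)} -> {for proj x, continuous f}.
Proof. by move=> fc A /fc xA; apply/nbhs_proj. Qed.

Lemma near_continuous_at (T U : topologicalType) (f g : T -> U) t :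
  (\forall s \near t, f s = g s) -> {for t, continuous g} ->
  {for t, continuous f}.
Proof.
move=> fg gc; rewrite /prop_for /continuous_at (nbhs_singleton fg).
by apply: cvg_trans gc; apply: near_eq_cvg; apply: filterS fg => s ->.
Qed.

Lemma strip_chartP a : is_chart (strip_chart a).
Proof.
split; rewrite ?strip_chart_image /=.
- exact/proj_open/strip_open.
- exact: strip_open.
- by move=> _ [x xs <-]; rewrite sheet_repr sheet_strip.
- rewrite continuous_open_subspace; last exact/proj_open/strip_open.
  move=> p; rewrite inE -(heis_reprK p) => /strip_sheet ps.
  apply: continuous_at_proj.
  have [k kP] := sheet_near (@coord4_continuous (heis_repr p)) ps.
  apply: near_continuous_at (@shift_continuous k (heis_repr p)).
  by apply: filterS kP => s <- /=; rewrite sheet_repr.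
- by apply: continuous_subspaceT; exact: proj_continuous.
Qed.

Definition heis_atlas : set (chart R (heis R) 5) := range strip_chart.

Lemma shift_analytic_at k a : analytic_at (@shift R k) a.
Proof.
apply: polynomial_analytic_at => j.
under eq_fun do rewrite shiftE.
apply: polynomial_at_add; first exact: polynomial_at_coord.
exact: polynomial_at_cst.
Qed.

(** Transition maps are locally integer shifts. *)
Lemma heis_analytic_atlas : analytic_atlas heis_atlas.
Proof.
split=> [_ [a _ <-]|p|_ _ [a _ <-] [b _ <-] p].
- exact: strip_chartP.
(* Starting 1/2 below the last coordinate puts the point in the middle of the strip. *)
- exists (strip_chart (heis_repr p ord0 (o 4) - 1 / 2)); first by eexists.
  exists (heis_repr p); last exact: heis_reprK.
  by rewrite /strip /=; apply/andP; split; lra.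
- move=> _; rewrite /= -{1}(heis_reprK p) -(proj_sheet a) => /strip_sheet ys.
  have [k kP] := sheet_near (@coord4_continuous _) ys.
  apply: near_analytic_at (shift_analytic_at k _).
  by apply: filterS kP => s <- /=; rewrite sheet_repr.
Qed.

HB.instance Definition _ := isAnalyticManifold.Build R (heis R)
  heis_analytic_atlas heis_hausdorff heis_second_countable.

(** * Group operations on the quotient and their analyticity *)

Definition heis_mul p q : heis R := proj (vmul (heis_repr p) (heis_repr q)).
Definition heis_inv p : heis R := proj (vinv (heis_repr p)).

Lemma heis_mul_proj x y : heis_mul (proj x) (proj y) = proj (vmul x y).
Proof.
have /esym/projP[k xk] := heis_reprK (proj x).
have /esym/projP[l yl] := heis_reprK (proj y).
by apply/esym/projP; exists (k + l); rewrite xk yl vmul_shift.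
Qed.

Lemma heis_inv_proj x : heis_inv (proj x) = proj (vinv x).
Proof.
have /esym/projP[k xk] := heis_reprK (proj x).
by apply/esym/projP; exists (- k); rewrite xk vinv_shift.
Qed.

Lemma heis_mulA : associative heis_mul.
Proof.
move=> p q r; rewrite -(heis_reprK p) -(heis_reprK q) -(heis_reprK r).
by rewrite !heis_mul_proj vmulA.
Qed.

Lemma heis_mul1 : right_id (proj 0) heis_mul.
Proof. by move=> p; rewrite -(heis_reprK p) heis_mul_proj vmul0. Qed.

Lemma heis_1mul : left_id (proj 0) heis_mul.
Proof. by move=> p; rewrite -(heis_reprK p) heis_mul_proj v0mul. Qed.

Lemma heis_mulV : right_inverse (proj 0) heis_inv heis_mul.
Proof.
by move=> p; rewrite -(heis_reprK p) heis_inv_proj heis_mul_proj vmulV.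
Qed.

Lemma heis_Vmul : left_inverse (proj 0) heis_inv heis_mul.
Proof.
by move=> p; rewrite -(heis_reprK p) heis_inv_proj heis_mul_proj vVmul.
Qed.

HB.instance Definition _ := isGroup.Build (heis R)
  heis_mulA heis_1mul heis_mul1 heis_Vmul heis_mulV.

Lemma mulg_proj x y : (proj x * proj y)%g = proj (vmul x y).
Proof. exact: heis_mul_proj. Qed.

Lemma invg_proj x : ((proj x)^-1)%g = proj (vinv x).
Proof. exact: heis_inv_proj. Qed.

Lemma vmul_continuous :
  continuous (fun xy : 'rV[R]_5 * 'rV[R]_5 => vmul xy.1 xy.2).
Proof.
move=> xy; have c1 i : {for xy, continuous
    (fun xy : 'rV[R]_5 * 'rV[R]_5 => xy.1 ord0 i)}.
  by apply: (cvg_comp (@fst _ _) (fun x : 'rV[R]_5 => x ord0 i));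
    [exact: cvg_fst|exact: coord_continuous].
have c2 i : {for xy, continuous
    (fun xy : 'rV[R]_5 * 'rV[R]_5 => xy.2 ord0 i)}.
  by apply: (cvg_comp (@snd _ _) (fun x : 'rV[R]_5 => x ord0 i));
    [exact: cvg_snd|exact: coord_continuous].
rewrite /vmul /cocycle; apply: cvgD.
  by apply: cvgD; [exact: cvg_fst|exact: cvg_snd].
by apply: cvgD; apply: cvgZr_tmp; apply: continuousM.
Qed.

Lemma vinv_continuous : continuous (@vinv R).
Proof.
move=> x; have c i : {for x, continuous (fun x : 'rV[R]_5 => x ord0 i)}.
  exact: coord_continuous.
have cZ i j k : {for x, continuous
    (fun x : 'rV[R]_5 => (x ord0 i * x ord0 j) *: axis R k)}.
  by apply: continuousZr_tmp; apply: continuousM.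
exact: (continuousD (@oppr_continuous _ _ x)
  (continuousD (cZ _ _ _) (cZ _ _ _))).
Qed.

(** A product neighbourhood found upstairs is pushed down factor by factor, which works because
    [proj] is open. *)
Lemma heis_mul_continuous :
  continuous (fun pq : heis R * heis R => (pq.1 * pq.2)%g).
Proof.
move=> [p q] A /=; rewrite -(heis_reprK p) -(heis_reprK q) mulg_proj.
move=> /nbhs_proj /(@vmul_continuous (heis_repr p, heis_repr q) _) [[U V] /= [Up Vq] UV].
exists (@proj R @` U, @proj R @` V); first by split; exact: proj_image_nbhs.
move=> [_ _] /= [[x Ux <-] [y Vy <-]]; rewrite mulg_proj.
exact: (UV (x, y)).
Qed.

Lemma heis_inv_continuous : continuous (fun p : heis R => (p^-1)%g).
Proof.
move=> p; rewrite -(heis_reprK p); apply: continuous_at_proj => A.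
rewrite /= invg_proj => /nbhs_proj/vinv_continuous.
apply: (@filterS _ _ (nbhs_filter (heis_repr p))) => x.
by rewrite /= invg_proj.
Qed.

(** Read in charts, the product is near each point the polynomial map [g] followed by one integer
    shift. *)
Lemma heis_mul_analytic : analytic_map
  (prod_atlas (@heis_atlas) heis_atlas) heis_atlas
  (fun pq : heis R * heis R => (pq.1 * pq.2)%g).
Proof.
split; first exact: heis_mul_continuous.
move=> _ _ [_ [a _ <-] [_ [b _ <-] <-]] [c _ <-] [p q] /=.
move=> _; set v := row_mx _ _.
pose g (v : 'rV[R]_(5 + 5)) := vmul (lsubmx v) (rsubmx v).
have gv : proj (g v) = (p * q)%g.
  by rewrite /g row_mxKl row_mxKr -mulg_proj !proj_sheet !heis_reprK.
rewrite -gv => /strip_sheet gs.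
(* This quadratic form serves twice: for the continuity that [sheet_near] requires and for
   analyticity. *)
have gE j u : g u ord0 j = u ord0 (lshift 5 j) + u ord0 (rshift 5 j) +
    (j == o 3)%:R * (u ord0 (lshift 5 (o 0)) * u ord0 (rshift 5 (o 1))) +
    (j == o 4)%:R * (u ord0 (lshift 5 (o 0)) * u ord0 (rshift 5 (o 2))).
  by rewrite /g vmulE !mxE; ring.
have [|k kP] := sheet_near _ gs.
  apply: near_continuous_at (@filterE _ _ (nbhs_filter v) _ (gE _)) _.
  have cE i : {for v, continuous (fun u : 'rV[R]_(5 + 5) => u ord0 i)}.
    exact: coord_continuous.
  have cM d i j : {for v, continuous
      (fun u : 'rV[R]_(5 + 5) => d * (u ord0 i * u ord0 j))}.
    by apply: continuousM; [exact: cst_continuous|apply: continuousM].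
  exact: (continuousD (continuousD (continuousD (cE _) (cE _)) (cM _ _ _))
    (cM _ _ _)).
apply: (@near_analytic_at _ _ _ _ (fun u => shift k (g u))).
  apply: filterS kP => s <- /=.
  by rewrite mulg_proj sheet_repr.
apply: polynomial_analytic_at => j.
under eq_fun do rewrite shiftE gE.
apply: polynomial_at_add; last exact: polynomial_at_cst.
apply: polynomial_at_add; last first.
  exact/polynomial_at_scale/polynomial_at_coordM.
apply: polynomial_at_add; last first.
  exact/polynomial_at_scale/polynomial_at_coordM.
by apply: polynomial_at_add; exact: polynomial_at_coord.
Qed.

Lemma heis_inv_analytic : analytic_map (@heis_atlas) heis_atlas
  (fun p : heis R => (p^-1)%g).
Proof.
split; first exact: heis_inv_continuous.
move=> _ _ [a _ <-] [b _ <-] p /= _; set v := sheet _ _.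
have -> : p = proj v by rewrite proj_sheet heis_reprK.
rewrite invg_proj => /strip_sheet vs.
have [|k kP] := sheet_near _ vs.
  apply: (cvg_comp (@vinv R) (fun x => x ord0 (o 4))).
    exact: vinv_continuous.
  exact: coord_continuous.
apply: (@near_analytic_at _ _ _ _ (fun u => shift k (vinv u))).
  by apply: filterS kP => s <- /=; rewrite invg_proj sheet_repr.
apply: polynomial_analytic_at => j.
have E u : shift k (vinv u) ord0 j = -1 * u ord0 j +
    (j == o 3)%:R * (u ord0 (o 0) * u ord0 (o 1)) +
    (j == o 4)%:R * (u ord0 (o 0) * u ord0 (o 2)) +
    k%:~R * (j == o 4)%:R.
  by rewrite shiftE vinvE; ring.
under eq_fun do rewrite E.
apply: polynomial_at_add; last exact: polynomial_at_cst.
apply: polynomial_at_add; last first.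
  exact/polynomial_at_scale/polynomial_at_coordM.
apply: polynomial_at_add; last first.
  exact/polynomial_at_scale/polynomial_at_coordM.
exact/polynomial_at_scale/polynomial_at_coord.
Qed.

HB.instance Definition _ := isLieGroup.Build R (heis R)
  heis_mul_analytic heis_inv_analytic.

End HeisenbergTopology.

(** * Commutator equations in the language of groups *)

Section Commutators.
Variable G : groupType.

(** The signature has multiplication only, so commutators must be expressed without inverses. *)
Lemma commg_eqP (g h c : G) : (g * h = h * g * c <-> [~ g, h] = c)%g.
Proof. by rewrite commgC; split=> [/mulgI|->]. Qed.

Section Formulas.
Variable V : Type.
Implicit Types t u c : term group_sig V.

Definition mul_term t u : term group_sig V :=
  @App group_sig V tt (fun i : 'I_2 => if i == ord0 then t else u).

Definition comm_formula t u c : formula group_sig V :=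
  Equal (mul_term t u) (mul_term (mul_term u t) c).

Lemma holds_comm (e : V -> G) t u c :
  holds (group_structure G) e (comm_formula t u c) <->
  [~ eval (group_structure G) e t, eval (group_structure G) e u]%g =
  eval (group_structure G) e c.
Proof. exact: commg_eqP. Qed.

End Formulas.
End Commutators.

(** * Real arithmetic on a line of commutators *)

Section HeisenbergArithmetic.
Variable R : realType.
Implicit Types (x y z : 'rV[R]_5) (p q : heis R).

Local Notation o k := (@Ordinal 5 k isT).
Local Notation H := (group_structure (heis R)).

Definition plane (s t : R) : 'rV[R]_5 := s *: axis R (o 3) + t *: axis R (o 4).

Lemma planeE s t j :
  plane s t ord0 j = s * (j == o 3)%:R + t * (j == o 4)%:R.
Proof. by rewrite !mxE. Qed.

(** The coordinate along [e_3] survives exactly and will carry the reals; the one along [e_4]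
    survives modulo 1 and will detect integers. *)
Lemma proj_plane s t s' t' :
  proj (plane s t) = proj (plane s' t') <->
  s = s' /\ exists k : int, t' = t + k%:~R.
Proof.
rewrite projP; split=> [[k /rowP e]|[-> [k ->]]].
  move: (e (o 3)) (e (o 4)); rewrite !shiftE !planeE /= => e3 e4.
  split; first by move: e3; rewrite !(mulr1, mulr0, addr0).
  by exists k; move: e4; rewrite !(mulr1, mulr0, add0r).
by exists k; apply/rowP => j; rewrite shiftE !planeE; ring.
Qed.

(** The additive parts cancel and the antisymmetrised cocycle remains. *)
Lemma commg_proj x y : [~ proj x, proj y]%g =
  proj (plane (x ord0 (o 0) * y ord0 (o 1) - y ord0 (o 0) * x ord0 (o 1))
              (x ord0 (o 0) * y ord0 (o 2) - y ord0 (o 0) * x ord0 (o 2))).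
Proof.
apply/commg_eqP; rewrite (mulg_proj x y) (mulg_proj y x) mulg_proj.
congr proj; apply/rowP => j; rewrite !vmulE !planeE /=; ring.
Qed.

Lemma one_plane : 1%g = proj (plane 0 0) :> heis R.
Proof. by congr proj; rewrite /plane !scale0r addr0. Qed.

(** Commutators have vanishing coordinates 0, 1, 2, so iterated commutators are trivial: the class
    is at most two. *)
Lemma heis_nilpotent : nilpotent_group (heis R).
Proof.
exists 2%N; apply/seteqP; split=> // p _ q r /=.
rewrite -(heis_reprK p) -(heis_reprK q) -(heis_reprK r).
by rewrite (commg_proj (heis_repr p)) commg_proj !planeE one_plane /=
  !(mulr0, mul0r, addr0, subr0).
Qed.

Definition line (s : R) : heis R := proj (plane s 0).

Lemma line_inj : injective line.
Proof. by move=> s t /proj_plane[]. Qed.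

Lemma line_mul s t : (line s * line t)%g = line (s + t).
Proof.
rewrite mulg_proj; congr proj; apply/rowP => j.
by rewrite vmulE !planeE /=; ring.
Qed.

Definition gen (i : 'I_5) : heis R := proj (axis R i).

Lemma axisE i j : axis R i ord0 j = (j == i)%:R.
Proof. by rewrite mxE. Qed.

(** Commutators with fixed parameters make coordinates of [x] visible to formulas: [gen (o 0)] shows
    coordinates 1 and 2, while [gen (o 1)] and [gen (o 2)] show coordinate 0, exactly and modulo
    1. *)
Lemma commg_gen0 x : [~ gen (o 0), proj x]%g =
  proj (plane (x ord0 (o 1)) (x ord0 (o 2))).
Proof. by rewrite commg_proj !axisE /= !(mul1r, mulr0, subr0). Qed.

Lemma commg_gen1 x : [~ proj x, gen (o 1)]%g = line (x ord0 (o 0)).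
Proof. by rewrite commg_proj !axisE /= !(mulr1, mulr0, mul0r, subr0). Qed.

Lemma commg_gen2 x : [~ proj x, gen (o 2)]%g = proj (plane 0 (x ord0 (o 0))).
Proof. by rewrite commg_proj !axisE /= !(mulr1, mulr0, mul0r, subr0). Qed.

Definition code_line (s : R) : 'I_1 -> heis R := fun=> line s.

Lemma code_line_inj : injective code_line.
Proof. by move=> s t /(congr1 (@^~ ord0))/line_inj. Qed.

Lemma scale_axisE (s : R) i j : (s *: axis R i) ord0 j = s * (j == i)%:R.
Proof. by rewrite !mxE. Qed.

Lemma definable_line : definable H (range code_line).
Proof.
exists (Exists (comm_formula (Var _ None) (Var _ (Some (inr (gen (o 1)))))
  (Var _ (Some (inl ord0))))) => v.
transitivity (exists u, [~ u, gen (o 1)]%g = v ord0).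
  split=> [[s _ <-]|[u]].
    exists (proj (s *: axis R (o 0))).
    by rewrite commg_gen1 scale_axisE mulr1.
  rewrite -(heis_reprK u) commg_gen1 => uv; eexists => //.
  by apply/funext => i; rewrite ord1 -uv.
split=> [[u uv]|[u /holds_comm uv]]; exists u; last exact: uv.
exact/holds_comm.
Qed.

(** Since the line is definable, tuples can be restricted to codes, and [X] need only be correct
    there. *)
Lemma coded_line_definable k (P : set ('I_k -> R)) (X : set ('I_k -> heis R)) :
  definable H X -> (forall b, X (line \o b) <-> P b) ->
  definable H (coded_rel (fun s => [set code_line s]) P).
Proof.
move=> Xdef XP; pose g (i : 'I_k) (j : 'I_1) := (i, j).
have := definableI (definable_forall_fin
    (fun i => definable_reindex (g i) definable_line))
  (definable_reindex (g^~ ord0) Xdef).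
congr definable; apply/seteqP; split=> v /=.
  move=> [/= vL Xv].
  have /choice[b bv] : forall i, exists s, code_line s = v \o g i.
    by move=> i; have [s _ sv] := vL i; exists s.
  exists b => [|i]; last by rewrite bv.
  apply/XP; move: Xv; congr X; apply/funext => i /=.
  by rewrite -[RHS]/(code_line (b i) ord0) bv.
move=> [b Pb bv]; split=> [i|]; first by exists (b i) => //; exact/esym/bv.
move/XP: Pb; congr X; apply/funext => i /=.
by rewrite -[LHS]/(code_line (b i) ord0) -(bv i).
Qed.

Lemma definable_int :
  definable H (coded_rel (fun s => [set code_line s])
    [set v : 'I_1 -> R | v ord0 \is a Num.int]).
Proof.
(* The first condition makes coordinate 0 of [u] the coded real; the second says that it vanishes
   modulo 1. *)
pose X := [set v : 'I_1 -> heis R | exists u,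
  [~ u, gen (o 1)]%g = v ord0 /\ [~ u, gen (o 2)]%g = 1%g].
apply: (@coded_line_definable _ _ X).
  exists (Exists (And
    (comm_formula (Var _ None) (Var _ (Some (inr (gen (o 1)))))
      (Var _ (Some (inl ord0))))
    (comm_formula (Var _ None) (Var _ (Some (inr (gen (o 2)))))
      (Var _ (Some (inr 1%g)))))) => v.
  split=> [[u [u1 u2]]|[u [/holds_comm u1 /holds_comm u2]]]; exists u.
    by split; apply/holds_comm.
  by split; [exact: u1|exact: u2].
move=> b; split=> [[u []]|/intrP[k bk]] /=.
  rewrite -(heis_reprK u) commg_gen1 commg_gen2 one_plane.
  move=> /line_inj <- /proj_plane[_ [k /eqP]].
  rewrite eq_sym addr_eq0 => /eqP ->.
  by rewrite rpredN intr_int.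
exists (proj (b ord0 *: axis R (o 0))).
rewrite commg_gen1 commg_gen2 scale_axisE mulr1 one_plane; split=> //.
by apply/proj_plane; split=> //; exists (- k); rewrite bk rmorphN addrN.
Qed.

Lemma definable_plus :
  definable H (coded_rel (fun s => [set code_line s])
    (fun_graph (real_int_structure R) (f := Plus))).
Proof.
(* As in [fun_graph], [ord_max] indexes the value and the lifted indices the arguments. *)
pose X := [set v : 'I_3 -> heis R |
  v ord_max = v (lift ord_max ord0) * v (lift ord_max ord_max)]%g.
apply: (@coded_line_definable _ _ X).
  by exists (Equal (Var _ (inl ord_max)) (mul_term
    (Var _ (inl (lift ord_max ord0))) (Var _ (inl (lift ord_max ord_max))))).
move=> b; rewrite /X /fun_graph /= line_mul.
by split=> [/line_inj|->].
Qed.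

Lemma definable_times :
  definable H (coded_rel (fun s => [set code_line s])
    (fun_graph (real_int_structure R) (f := Times))).
Proof.
(* [u] and [w] have first coordinates [(s, 0)] and [(0, t)], where [s] and [t]
   are the factors; [w_2] may be any integer, but [[u, w]] must lie on the
   line, so that its first coordinate [s t] determines it. *)
pose X := [set v : 'I_3 -> heis R | exists u w,
  [/\ [~ u, gen (o 1)] = v (lift ord_max ord0),
      [~ gen (o 0), u] = 1,
      [~ w, gen (o 1)] = 1,
      [~ gen (o 0), w] = v (lift ord_max ord_max) &
      [~ u, w] = v ord_max]]%g.
apply: (@coded_line_definable _ _ X).
  (* Under two quantifiers the inner variable [w] is [None], the outer one [u] is [Some None], and
     coordinates and parameters carry two [Some]. *)
  pose u := Var group_sig (Some (@None ('I_3 + heis R))).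
  pose w := Var group_sig (@None (option ('I_3 + heis R))).
  pose i j := Var group_sig (Some (Some (inl j : 'I_3 + heis R))).
  pose c g := Var group_sig (Some (Some (inr g : 'I_3 + heis R))).
  exists (Exists (Exists (
    And (comm_formula u (c (gen (o 1))) (i (lift ord_max ord0)))
   (And (comm_formula (c (gen (o 0))) u (c 1%g))
   (And (comm_formula w (c (gen (o 1))) (c 1%g))
   (And (comm_formula (c (gen (o 0))) w (i (lift ord_max ord_max)))
        (comm_formula u w (i ord_max)))))))) => v.
  split=> [[a [b [h1 h2 h3 h4 h5]]]|[a [b]]].
    by exists a, b; do !split; apply/holds_comm.
  move=> [/holds_comm h1 [/holds_comm h2 [/holds_comm h3]]].
  move=> [/holds_comm h4 /holds_comm h5]; exists a, b.
  by split; [exact: h1|exact: h2|exact: h3|exact: h4|exact: h5].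
move=> b; split=> [[u [w []]]|].
  rewrite /= -(heis_reprK u) -(heis_reprK w) !commg_gen0 !commg_gen1 commg_proj.
  rewrite one_plane.
  move=> /line_inj u0 /proj_plane[u1 _] /proj_plane[w0 _] /proj_plane[w1 _].
  move=> /proj_plane[uw _]; rewrite /fun_graph /= -uw u0 w1.
  by rewrite u1 mulr0 subr0.
rewrite /fun_graph /= => bE.
(* Multiples of [e_0] and [e_1] satisfy the triviality conditions, and their commutator lies on the
   line at the product of the scalars. *)
exists (proj (b (lift ord_max ord0) *: axis R (o 0))).
exists (proj (b (lift ord_max ord_max) *: axis R (o 1))).
rewrite /= !commg_gen0 !commg_gen1 commg_proj one_plane !scale_axisE /=.
by rewrite bE !(mulr0, mul0r, mulr1, subr0).
Qed.

Lemma heis_defines : defines H (real_int_structure R).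
Proof.
apply: (defines_of_injection code_line_inj definable_line).
split=> [[]|[]].
- exact: definable_int.
- exact: definable_plus.
- exact: definable_times.
Qed.

End HeisenbergArithmetic.

Theorem theorem2p3 (R : realType) :
  (exists G : lieGroupType R,
     [/\ connected [set: G],
         nilpotent_group G &
         interprets (group_structure G) (real_int_structure R)]) /\
  (exists G' : lieGroupType R,
     connected [set: G'] /\
     defines (group_structure G') (real_int_structure R)).
Proof.
have Hdef := @heis_defines R.
split; exists (heis R); split; try exact: heis_connected => //.
- exact: heis_nilpotent.
- exact: defines_interprets.
- exact: Hdef.
Qed.
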